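(* Consider a general $M\times K$ F-RAN with pipelined fronthaul-edge transmission, $N\ge K$ files and fronthaul rate $r>0$. Let $$\mu_1=\left(\frac{K-\max\{M,K\}\,r}{KM+Mr[\min\{M,K\}-1]}\right)^+,\qquad \mu_2=\left(1-\frac{Mr}{\min\{M,K\}}\right)^+,$$ with $(x)^+=\max\{0,x\}$ (so $\mu_1\le\mu_2\le 1$), and for $\mu\in[\mu_1,\mu_2]$ let $$\delta_{\mathsf{P,Ach}}(\mu,r)=\begin{cases}\dfrac{K}{Mr}\left[1-\mu_2-(\mu_1M-\mu_2)\dfrac{\mu_2-\mu}{\mu_2-\mu_1}\right], & \mu\in[\mu_1,\mu_2),\\[8pt] \dfrac{K}{\min\{M,K\}}, & \mu=\mu_2.\end{cases}$$ Then the minimum NDT $\delta^*_{\mathsf P}(\mu,r)$ satisfies $$\frac{\delta_{\mathsf{P,Ach}}(\mu,r)}{\delta^*_{\mathsf P}(\mu,r)}\le2\qquad\text{for all }\mu\in[\mu_1,\mu_2].$$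
   Context: F-RAN model with pipelined fronthaul-edge transmission. $M$ edge nodes (ENs) serve $K$ users from a library of $N\ge K$ files $F_1,\dots,F_N$, independent and uniform on $\{1,\dots,2^L\}$. The channel $\mathbf H=(h_{km})\in\mathbb C^{K\times M}$ has entries drawn i.i.d. from a continuous distribution, is constant during a transmission interval and known to all nodes. The demand vector $\mathbf D=(d_1,\dots,d_K)\in\{1,\dots,N\}^K$ is known to the cloud and ENs. With power $P$ and fronthaul rate $r$, put $C_F=r\log P$. A policy for file size $L$ with latency $T$ (symbols) consists of: (a) caching functions $S_{m,n}=\pi^m_{c,n}(F_n)$ with entropy $H(S_{m,n})\le\mu L$ (not depending on $\mathbf D,\mathbf H$; $\mu\in[0,1]$ is the fractional cache size), with $S_m=(S_{m,1},\dots,S_{m,N})$; (b) fronthaul messages $U_m[1],\dots,U_m[T]$, functions of $(F_1,\dots,F_N,S_m,\mathbf D,\mathbf H)$, sent to EN $m$ over a link of capacity $C_F$ bits per symbol; (c) edge signals $X_m[t]=\pi^m_{\mathsf P,e}(S_m,U_m[1],\dots,U_m[t-1],\mathbf D,\mathbf H)\in\mathbb C$, $t\in\{1,\dots,T\}$, with average power at most $P$; (d) decoders $\widehat F_{d_k}=\pi_d^k(Y_k[1],\dots,Y_k[T],d_k,\mathbf H)$, where $Y_k[t]=\sum_{m=1}^M h_{km}X_m[t]+n_k[t]$ with noise i.i.d. $\mathcal{CN}(0,1)$ over time and users. The error probability is $P_e=\max_{\mathbf D}\max_k\mathbb P(\widehat F_{d_k}\ne F_{d_k})$. A sequence of policies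 indexed by $L$ is feasible if, for almost all $\mathbf H$, $P_e\to0$ as $L\to\infty$. For feasible sequences of policies the achievable NDT is $\delta_{\mathsf P}(\mu,r)=\lim_{P\to\infty}\limsup_{L\to\infty}\frac{T}{L/\log P}$, and the minimum NDT $\delta^*_{\mathsf P}(\mu,r)$ is the infimum of all achievable $\delta_{\mathsf P}(\mu,r)$. *)

(* Defs.v *)
From HB Require Import structures.
From mathcomp Require Import all_boot all_order all_algebra.
From mathcomp Require Import complex.
From mathcomp Require Import all_classical all_reals all_analysis.

Set Implicit Arguments.
Unset Strict Implicit.
Unset Printing Implicit Defensive.

Import Order.TTheory GRing.Theory Num.Theory.
Import numFieldNormedType.Exports.

Local Open Scope classical_set_scope.
Local Open Scope complex_scope.
Local Open Scope ring_scope.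

Section InformationMeasures.
Context {R : realType}.

Definition log2 (x : R) : R := ln x / ln 2.

(* Shannon entropy, in bits, of [f W] for [W] uniform on the finite type [T]. *)
Definition entropy (T : finType) (A : eqType) (f : T -> A) : R :=
  - \sum_(a <- undup (codom f))
      let p : R := #|[pred w | f w == a]|%:R / #|T|%:R in p * log2 p.

End InformationMeasures.

Section RandomVariables.
Context {R : realType}.

(* The [X i] are mutually independent with common law [nu]; singletons [J] give
   the marginal laws. *)
Definition iid d d' (Om : measurableType d) (T : measurableType d')
    (Pr : probability Om R) (I : choiceType) (nu : set T -> \bar R)
    (X : I -> {RV Pr >-> T}) : Prop :=
  forall (J : seq I) (B : I -> set T), uniq J ->
    (forall i, measurable (B i)) ->
    Pr (\bigcap_(i in [set` J]) X i @^-1` B i) =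
      (\prod_(i <- J) fine (nu (B i)))%:E.

(* Random complex numbers are represented by their real and imaginary parts. *)
Definition to_complex (z : R * R) : R[i] := z.1 +i* z.2.
Definition of_complex (z : R[i]) : R * R := (complex.Re z, complex.Im z).

(* Law of CN(0,1): independent real and imaginary parts, each of law N(0,1/2);
   the second argument of [normal_prob] is the standard deviation. *)
Definition CN01 : set (R * R) -> \bar R :=
  (normal_prob 0 (Num.sqrt (2^-1)) \x normal_prob 0 (Num.sqrt (2^-1)))%E.

End RandomVariables.

Section FRAN.
Context {R : realType} (M K N : nat).

Definition demand := {ffun 'I_K -> 'I_N}.
Definition channel := 'M[R[i]]_(K, M).
Definition library (L : nat) := {ffun 'I_N -> 'I_(2 ^ L)}.

(* Time slots are numbered from 0, only those smaller than [latency] being used.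
   For fixed demand and channel every cached content or fronthaul message is a
   function of finitely many files, hence takes finitely many values, encoded
   here as natural numbers. *)
Record policy (L : nat) := Policy {
  latency : nat;
  caching : 'I_M -> 'I_N -> 'I_(2 ^ L) -> nat;
  fronthaul : 'I_M -> nat -> library L -> ('I_N -> nat) ->
    demand -> channel -> nat;
  (* the [seq nat] argument is the fronthaul messages of the past slots *)
  edge : 'I_M -> nat -> ('I_N -> nat) -> seq nat -> demand -> channel -> R[i];
  decoder : 'I_K -> latency.-tuple (R * R) -> 'I_N -> channel -> 'I_(2 ^ L);
}.

Arguments decoder {L} p _ _ _ _ : rename.

Section Policy.
Variables (L : nat) (p : policy L).

Definition cached (w : library L) (m : 'I_M) : 'I_N -> nat :=
  fun n => caching p m n (w n).

Definition fh_message (D : demand) (H : channel) (w : library L)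
    (m : 'I_M) (t : nat) : nat :=
  fronthaul p m t w (cached w m) D H.

Definition edge_signal (D : demand) (H : channel) (w : library L)
    (m : 'I_M) (t : nat) : R[i] :=
  edge p m t (cached w m) (mkseq (fh_message D H w m) t) D H.

(* Averaged over time and over the uniform files. *)
Definition average_power (D : demand) (H : channel) (m : 'I_M) : R :=
  (latency p)%:R^-1 * \sum_(t < latency p)
    (#|library L|%:R^-1 * \sum_(w : library L)
      (complex.Re (edge_signal D H w m t) ^+ 2 +
       complex.Im (edge_signal D H w m t) ^+ 2)).

(* Cache size [mu], fronthaul rate [r], power [P]. *)
Definition admissible (mu r P : R) : Prop :=
  [/\ forall m n, entropy (caching p m n) <= mu * L%:R,
      forall D H m t, (t < latency p)%N ->
        entropy (fun w => fh_message D H w m t) <= r * log2 P,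
      forall D H m, average_power D H m <= P &
      forall k n H f, measurable [set y | decoder p k y n H = f] ].

Section Error.
Context d (Om : measurableType d) (Pr : probability Om R).
Variable Z : 'I_K * nat -> {RV Pr >-> (R * R)%type}.

Definition received (D : demand) (H : channel) (w : library L) (k : 'I_K)
    (x : Om) : (latency p).-tuple (R * R) :=
  [tuple of_complex (\sum_(m < M) H k m * edge_signal D H w m t
                     + to_complex (Z (k, nat_of_ord t) x)) | t < latency p].

(* The files are uniform and independent of the noise. *)
Definition user_error (H : channel) (D : demand) (k : 'I_K) : R :=
  #|library L|%:R^-1 * \sum_(w : library L)
    fine (Pr [set x | decoder p k (received D H w k x) (D k) H <> w (D k)]).

Definition error_probability (H : channel) : R :=
  \big[Num.max/0]_(D : demand) \big[Num.max/0]_(k < K) user_error H D k.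

End Error.
End Policy.

Section MinimumNDT.
Context dH (OmH : measurableType dH) (PrH : probability OmH R).
Variable h : 'I_K * 'I_M -> {RV PrH >-> (R * R)%type}.
Context dZ (OmZ : measurableType dZ) (PrZ : probability OmZ R).
Variable Z : 'I_K * nat -> {RV PrZ >-> (R * R)%type}.

Definition channel_matrix (x : OmH) : channel :=
  \matrix_(k, m) to_complex (h (k, m) x).

Definition feasible (mu r P : R) (pol : forall L, policy L) : Prop :=
  (forall L, admissible (pol L) mu r P) /\
  {ae PrH, forall x,
    (fun L => error_probability (pol L) Z (channel_matrix x)) @ \oo --> (0 : R)}.

(* One sequence of policies for each (large enough) power [P]. *)
Definition achievable_NDT (mu r : R) (delta : \bar R) : Prop :=
  exists pol : R -> forall L, policy L,
    (\forall P \near +oo, feasible mu r P (pol P)) /\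
    (fun P => limn_esup (fun L =>
       ((latency (pol P L))%:R / (L%:R / log2 P))%:E)) @ +oo --> delta.

Definition min_NDT (mu r : R) : \bar R := ereal_inf (achievable_NDT mu r).

End MinimumNDT.

Definition mu1 (r : R) : R :=
  Num.max 0 ((K%:R - (maxn M K)%:R * r) /
             (K%:R * M%:R + M%:R * r * ((minn M K)%:R - 1))).

Definition mu2 (r : R) : R := Num.max 0 (1 - M%:R * r / (minn M K)%:R).

(* Meant for [mu] between [mu1 r] and [mu2 r]. *)
Definition NDT_ach (mu r : R) : R :=
  if mu < mu2 r then
    K%:R / (M%:R * r) *
      (1 - mu2 r - (mu1 r * M%:R - mu2 r) * ((mu2 r - mu) / (mu2 r - mu1 r)))
  else K%:R / (minn M K)%:R.

End FRAN.

(* Main.v *)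
Require Import Defs.
From HB Require Import structures.
From mathcomp Require Import all_boot all_order all_algebra.
From mathcomp Require Import complex.
From mathcomp Require Import all_classical all_reals all_analysis.
From mathcomp Require Import measurable_realfun ring lra.

Set Implicit Arguments.
Unset Strict Implicit.
Unset Printing Implicit Defensive.

Import Order.TTheory GRing.Theory Num.Theory.
Import numFieldNormedType.Exports.
Local Open Scope classical_set_scope.
Local Open Scope ring_scope.

(** Already the cut-set bound [delta* >= K / min(M, K)] suffices: [NDT_ach] is a
    convex combination of its two corner values, each at most
    [2 K / min(M, K)].  The cut-set bound in turn follows from
    [2^(L K) <= 2 (Gamma P^q)^T] with [q = min(M, K)] and [Gamma] depending only
    on the channel.  To see this, round the [2 q T] real coordinates of the
    effective channel input of each message tuple to integers.  This moves
    every output by a bounded amount, and the law of the shifted Gaussian noise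
    is at most [C] times a fixed, wider Gaussian law per output symbol, so up to
    [C^(K T)] the decoders cannot distinguish message tuples rounded to the same
    lattice point.  The power constraint leaves [(const * P)^(q T)] lattice
    points. *)

(** * Domination of shifted Gaussians and of product measures *)

(** The reference law has variance [1] instead of [1/2]: against a wider Gaussian the density ratio
    of the shifted law is bounded. The ratio peaks at [x = 2 c], with value [sqrt 2 * exp (c^2)]. *)
Lemma normal_prob_shift_le (R : realType) (rho c : R) (B : set R) :
  `|c| <= rho -> measurable B ->
  (normal_prob 0 (Num.sqrt (2^-1)) ((fun x => (x + c)%R) @^-1` B) <=
   (Num.sqrt 2 * expR (rho ^+ 2))%:E * normal_prob 0 1 B)%E.
Proof.
move=> c_le mB; rewrite /normal_prob.
pose shift : measurableTypeR R -> measurableTypeR R := fun x => x + c.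
have mshift : measurable_fun setT shift by exact: measurable_funD.
pose f (x : R) : \bar R := (normal_pdf 0 (Num.sqrt 2^-1) (x - c))%:E.
have mf : measurable_fun setT f.
  apply/measurable_EFinP; apply: measurableT_comp; first exact: measurable_normal_pdf.
  exact: measurable_funB.
(* Translation invariance of Lebesgue measure, checked on half-open intervals. *)
have leb_shift A : measurable A ->
    pushforward (@lebesgue_measure R) shift A = lebesgue_measure A.
  move=> mA; apply/esym/lebesgue_measure_unique => //= _ [[a b]] _ <-.
  rewrite /pushforward (_ : shift @^-1` _ = `]a - c, b - c]%classic); last first.
    by apply/seteqP; split=> x; rewrite /= !in_itv /= ltrBlDr lerBrDr.
  by rewrite !lebesgue_measure_itv/= !lte_fin ltrD2r -!EFinB opprB addrA subrK.
have -> : (\int[lebesgue_measure]_(x in (fun x : R => x + c)%R @^-1` B)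
      (normal_pdf 0 (Num.sqrt 2^-1) x)%:E = \int[lebesgue_measure]_(x in B) f x)%E.
  transitivity (\int[pushforward lebesgue_measure shift]_(x in B) f x)%E.
    rewrite ge0_integral_pushforward//.
    - by apply: eq_integral => x _; rewrite /f /= /shift addrK.
    - exact: measurable_funTS.
    - by move=> x _; rewrite lee_fin normal_pdf_ge0.
  by apply: eq_measure_integral => //= A mA AS; exact: leb_shift.
rewrite -ge0_integralZl//.
- apply: ge0_le_integral => //.
  + by move=> x _; rewrite lee_fin normal_pdf_ge0.
  + exact: measurable_funTS.
  + apply/measurable_EFinP; apply: measurable_funM => //.
    by apply: measurable_funTS; exact: measurable_normal_pdf.
  + move=> x _.
    have half_gt0 : 0 < (2^-1 : R) by rewrite invr_gt0.
    rewrite /f -EFinM lee_fin !normal_pdfE ?oner_eq0 ?gt_eqF ?sqrtr_gt0//.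
    rewrite /normal_fun /normal_peak !subr0 sqr_sqrtr ?invr_ge0// expr1n mul1r.
    rewrite -[2^-1 * pi *+ 2]mulr_natr mulrAC mulVf ?pnatr_eq0// mul1r.
    rewrite -[2^-1 *+ 2]mulr_natr mulVf ?pnatr_eq0// divr1 -[pi *+ 2]mulr_natr.
    rewrite sqrtrM ?pi_ge0// invfM mulrACA.
    have -> : (Num.sqrt 2 * ((Num.sqrt pi)^-1 * (Num.sqrt 2)^-1) = (Num.sqrt pi)^-1 :> R).
      by rewrite mulrCA divff ?mulr1// gt_eqF// sqrtr_gt0.
    rewrite ler_wpM2l ?invr_ge0// -expRD ler_expR.
    have c2 : c ^+ 2 <= rho ^+ 2.
      by rewrite -(real_normK (num_real c)) lerXn2r// nnegrE (le_trans _ c_le).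
    (* - (x - c)^2 + x^2 / 2 = c^2 - (x - 2 c)^2 / 2 *)
    have := sqr_ge0 (x - 2 * c).
    move: c2; rewrite !expr2 => c2; nra.
- by apply/measurable_funTS/measurable_EFinP; exact: measurable_normal_pdf.
- by move=> x _; rewrite lee_fin normal_pdf_ge0.
Qed.

(** One factor is replaced at a time: the second by integrating over x-sections, the first over
    y-sections. Uniqueness of the product measure ([swap]) passes between the two ways of
    integrating. *)
Lemma le_product_measure (R : realType) d1 d2
    (T1 : measurableType d1) (T2 : measurableType d2)
    (mu1 nu1 : probability T1 R) (mu2 nu2 : probability T2 R) (C1 C2 : R) :
  0 <= C1 -> 0 <= C2 ->
  (forall A, measurable A -> mu1 A <= C1%:E * nu1 A)%E ->
  (forall A, measurable A -> mu2 A <= C2%:E * nu2 A)%E ->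
  forall A, measurable A -> ((mu1 \x mu2) A <= (C1 * C2)%:E * (nu1 \x nu2) A)%E.
Proof.
move=> C1_ge0 C2_ge0 le1 le2 A mA.
have swap (m1 : probability T1 R) (m2 : probability T2 R) :
    ((m1 \x m2) A = (m1 \x^ m2) A)%E.
  by apply: product_measure_unique => // B C mB mC; rewrite /= product_measure2E.
apply: (@le_trans _ _ (C2%:E * (mu1 \x nu2) A)%E).
  rewrite /product_measure1 -ge0_integralZl//; last exact: measurable_fun_xsection.
  apply: ge0_le_integral => //.
  - exact: measurable_fun_xsection.
  - by apply: measurable_funeM; exact: measurable_fun_xsection.
  - by move=> x _; apply: le2; exact: measurable_xsection.
rewrite mulrC EFinM -muleA lee_wpmul2l ?lee_fin//.
rewrite !swap /product_measure2 -ge0_integralZl//; last exact: measurable_fun_ysection.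
apply: ge0_le_integral => //.
- exact: measurable_fun_ysection.
- by apply: measurable_funeM; exact: measurable_fun_ysection.
- by move=> x _; apply: le1; exact: measurable_ysection.
Qed.

(** * Laws of tuples of independent slots *)

Section Tuple.
Context {R : realType} d (Om : measurableType d) (Pr : probability Om R).
Context dT (T : measurableType dT).

(** Only the full family of [n] slots has to factor: subfamilies are covered by taking
    [B i = setT]. *)
Definition independent_slots (n : nat) (X : nat -> Om -> T) :=
  forall B : nat -> set T, (forall i, measurable (B i)) ->
    Pr (\bigcap_(i < n) X i @^-1` B i) = (\prod_(i < n) Pr (X i @^-1` B i))%E.

Definition slots (n : nat) (X : nat -> Om -> T) (x : Om) : n.-tuple T :=
  [tuple X i x | i < n].

Lemma measurable_slots n X : (forall i, measurable_fun setT (X i)) ->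
  measurable_fun setT (slots n X).
Proof.
move=> mX; apply/measurable_fun_tnthP => i.
rewrite (_ : _ \o _ = X i) //; by apply/funext => x; rewrite /= tnth_mktuple.
Qed.

(** As functions of [A], both sides are finite measures on tuples. They agree on boxes, which are
    stable under intersection and generate the sigma-algebra. *)
Lemma independent_head_tail n (X : nat -> Om -> T) :
  (forall i, measurable_fun setT (X i)) ->
  independent_slots n.+1 X ->
  forall B A, measurable B -> measurable A ->
  Pr (X 0%N @^-1` B `&` slots n (fun i => X i.+1) @^-1` A) =
  (Pr (X 0%N @^-1` B) * Pr (slots n (fun i => X i.+1) @^-1` A))%E.
Proof.
move=> mX indep B A mB mA.
pose V : Om -> n.-tuple T := slots n (fun i => X i.+1).
have mV : measurable_fun setT V by apply: measurable_slots => i; exact: mX.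
have mXB i C : measurable C -> measurable (X i @^-1` C).
  by move=> mC; rewrite -[_ @^-1` _]setTI; exact: mX.
pose Vf : {mfun Om >-> n.-tuple T} := HB.pack V (isMeasurableFun.Build _ _ _ _ V mV).
have p_ge0 : 0 <= fine (Pr (X 0%N @^-1` B)) by exact: fine_ge0.
pose m1_ : {measure set (n.-tuple T) -> \bar R} :=
  pushforward (mrestr Pr (mXB 0%N B mB)) V.
pose m1 := m1_ mV.
pose m2 : {measure set (n.-tuple T) -> \bar R} :=
  mscale (NngNum p_ge0) (distribution Pr Vf).
pose G : set (set (n.-tuple T)) := [set C | exists2 D : nat -> set T,
  forall i, measurable (D i) & C = [set t | forall i : 'I_n, D i (tnth t i)]].
have m1E C : m1 C = Pr (X 0%N @^-1` B `&` V @^-1` C) by rewrite setIC.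
have m2E C : m2 C = (Pr (X 0%N @^-1` B) * Pr (V @^-1` C))%E.
  by rewrite -[in RHS](fineK (fin_num_measure Pr _ (mXB 0%N B mB))).
rewrite -m1E -m2E.
apply: (@g_sigma_algebra_measure_unique _ _ _ G _ (fun=> setT)) => //.
- move=> C [D mD ->].
  rewrite (_ : [set t | _] = \bigcap_(i in [set: 'I_n]) (@tnth n T ^~ i) @^-1` D i).
    apply: fin_bigcap_measurable => // i _; rewrite -[_ @^-1` _]setTI.
    by apply: measurable_tnth.
  by apply/seteqP; split=> t /= Dt i; [move=> _; exact: Dt|exact: Dt].
- by move=> _; exists (fun=> setT) => //; apply/seteqP; split.
- by rewrite bigcup_const//.
- move=> C1 C2 [D1 mD1 ->] [D2 mD2 ->]; exists (fun i => D1 i `&` D2 i).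
    by move=> i; exact: measurableI.
  apply/seteqP; split=> t /=; first by move=> [h1 h2] i; split; [exact: h1|exact: h2].
  by move=> h; split=> i; have [] := h i.
- move=> C [D mD ->]; rewrite m1E m2E.
  (* [D'] puts [B] in front of the box; [D0] puts [setT] there, which yields the law of the tail
     alone. *)
  pose D' i := if i is j.+1 then D j else B.
  have mD' i : measurable (D' i) by case: i.
  pose D0 i := if i is j.+1 then D j else setT.
  have mD0 i : measurable (D0 i) by case: i => //; exact: measurableT.
  have capE (E : nat -> set T) : \bigcap_(i < n.+1) X i @^-1` E i =
      X 0%N @^-1` E 0%N `&` V @^-1` [set t | forall i : 'I_n, E i.+1 (tnth t i)].
    apply/seteqP; split=> x /=.
      move=> Ex; split; first exact: (Ex 0%N).
      by move=> i; rewrite tnth_mktuple; apply: (Ex i.+1); rewrite /= ltnS.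
    move=> [E0 ES] [_ //|i] /=; rewrite ltnS => i_lt.
    by have := ES (Ordinal i_lt); rewrite tnth_mktuple.
  have := indep _ mD'; rewrite capE => ->; rewrite big_ord_recl; congr (_ * _)%E.
  have := indep _ mD0; rewrite capE preimage_setT setTI big_ord_recl => ->.
  by rewrite preimage_setT probability_setT mul1e.
- move=> _; rewrite m1E; apply: (le_lt_trans (probability_le1 _ _)); last by rewrite ltry.
  by rewrite preimage_setT setIT; exact: (mXB _ _ mB).
- move: mA; apply: smallest_sub; first exact: smallest_sigma_algebra.
  rewrite -bigcup_seq => C [i _ [D mD <-]]; apply: sub_sigma_algebra.
  exists (fun j : nat => if j == val i then D else setT) => [j|]; first by case: ifP.
  apply/seteqP; split=> t /=.
    by move=> [_ Dt] j; case: ifPn => // /eqP/val_inj ->.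
  by move=> Dt; split=> //; have := Dt i; rewrite eqxx.
Qed.
End Tuple.

(** Induction on [n], with [Q] the law of a [nu]-distributed head put before the previous [Q]. Since
    [Q] is chosen before [X], one reference law serves all signals. *)
Lemma slots_law_le (R : realType) dT (T : measurableType dT)
    (nu : probability T R) (C : R) (n : nat) :
  0 <= C ->
  exists Q : probability (n.-tuple T) R,
    forall d (Om : measurableType d) (Pr : probability Om R) (X : nat -> Om -> T),
      (forall i, measurable_fun setT (X i)) ->
      independent_slots Pr n X ->
      (forall i A, measurable A -> Pr (X i @^-1` A) <= C%:E * nu A)%E ->
      forall A, measurable A -> (Pr (slots n X @^-1` A) <= (C ^+ n)%:E * Q A)%E.
Proof.
move=> C_ge0; elim: n => [|n [Q domQ]].
  exists (dirac [tuple] : probability (0.-tuple T) R) => d Om Pr X mX _ _ A mA.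
  rewrite expr0 mul1e /= diracE; have [A0|nA0] := boolP ([tuple] \in A).
    apply: (probability_le1 Pr).
    by rewrite -[_ @^-1` _]setTI; apply: measurable_slots => //.
  rewrite (_ : _ @^-1` _ = set0) ?measure0//; apply/seteqP; split=> // x /=.
  by rewrite [slots _ _ _]tuple0 => /mem_set; exact/negP.
pose consf (z : T * n.-tuple T) : n.+1.-tuple T := [tuple of z.1 :: z.2].
have mcons : measurable_fun setT consf by exact: measurable_cons.
pose consm : {mfun (T * n.-tuple T)%type >-> n.+1.-tuple T} :=
  HB.pack consf (isMeasurableFun.Build _ _ _ _ consf mcons).
exists (distribution (nu \x Q)%E consm) => d Om Pr X mX indep domX A mA.
pose V := slots n (fun i => X i.+1).
have mV : measurable_fun setT V by apply: measurable_slots => i; exact: mX.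
pose X0m : {mfun Om >-> T} :=
  HB.pack (X 0%N) (isMeasurableFun.Build _ _ _ _ (X 0%N) (mX 0%N)).
pose Vm : {mfun Om >-> n.-tuple T} := HB.pack V (isMeasurableFun.Build _ _ _ _ V mV).
pose XV x := (X 0%N x, V x).
have mXV : measurable_fun setT XV by exact: measurable_fun_pair.
pose XVm : {mfun Om >-> (T * n.-tuple T)%type} :=
  HB.pack XV (isMeasurableFun.Build _ _ _ _ XV mXV).
have mcA : measurable (consf @^-1` A).
  by rewrite -[_ @^-1` _]setTI; exact: (mcons measurableT).
(* Independence of head and tail makes their joint law the product of the marginals, so
   [le_product_measure] applies. *)
have lawE : ((distribution Pr X0m \x distribution Pr Vm) (consf @^-1` A) =
    distribution Pr XVm (consf @^-1` A))%E.
  apply: (@product_measure_unique _ _ _ _ _ (distribution Pr X0m)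
    (distribution Pr Vm) (distribution Pr XVm)) => // B D mB mD.
  exact: (independent_head_tail mX indep mB mD).
have consE x : consf (X 0%N x, V x) = slots n.+1 X x.
  apply: eq_from_tnth => i; case: (unliftP ord0 i) => [k|] ->.
    by rewrite tnthS !tnth_mktuple.
  by rewrite tnth0 tnth_mktuple.
have -> : slots n.+1 X @^-1` A = XV @^-1` (consf @^-1` A).
  by apply/seteqP; split=> x /=; rewrite consE.
rewrite -[leLHS]/(distribution Pr XVm (consf @^-1` A)) -lawE exprS.
apply: le_product_measure => //; first exact: exprn_ge0.
- by move=> B mB; exact: domX.
- move=> B mB; apply: domQ => //.
    move=> D mD; pose D0 i := if i is j.+1 then D j else setT.
    have mD0 i : measurable (D0 i) by case: i => //; exact: measurableT.
    have := indep _ mD0; rewrite big_ord_recl /= preimage_setT probability_setT mul1e => <-.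
    congr (Pr _); apply/seteqP; split=> x /=.
      by move=> Dx [_ //|i]; rewrite /= ltnS => /Dx.
    by move=> Dx i i_lt; exact: (Dx i.+1).
  by move=> i; exact: domX.
Qed.

(** * Translated complex Gaussian noise *)

Definition translate (R : realType) (c z : R * R) : R * R := (z.1 + c.1, z.2 + c.2).

Lemma measurable_translate (R : realType) (c : R * R) : measurable_fun setT (translate c).
Proof.
apply: measurable_fun_pair.
- by apply: measurable_funD => //; exact: measurable_fst.
- by apply: measurable_funD => //; exact: measurable_snd.
Qed.

(** A translate of [CN01] is the product of two shifted real Gaussians, whence the square of the
    one-dimensional constant. *)
Lemma CN01_translate_le (R : realType) (rho : R) (c : R * R) (A : set (R * R)) :
  `|c.1| <= rho -> `|c.2| <= rho -> measurable A ->
  (CN01 (translate c @^-1` A) <=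
   ((Num.sqrt 2 * expR (rho ^+ 2)) ^+ 2)%:E *
     (normal_prob 0 1 \x normal_prob 0 1) A)%E.
Proof.
move=> c1_le c2_le mA; set C := Num.sqrt 2 * _.
have C_ge0 : 0 <= C by rewrite mulr_ge0// expR_ge0.
pose s : R := Num.sqrt 2^-1.
pose sh (a : R) : measurableTypeR R -> measurableTypeR R := fun x => x + a.
have msh a : measurable_fun setT (sh a) by exact: measurable_funD.
pose shm a : {mfun measurableTypeR R >-> measurableTypeR R} :=
  HB.pack (sh a) (isMeasurableFun.Build _ _ _ _ (sh a) (msh a)).
pose RR : measurableType _ := (measurableTypeR R * measurableTypeR R)%type.
pose tr : RR -> RR := translate c.
have mtr : measurable_fun setT tr := measurable_translate c.
pose trm : {mfun RR >-> RR} := HB.pack tr (isMeasurableFun.Build _ _ _ _ tr mtr).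
have -> : CN01 (translate c @^-1` A) =
    (distribution (normal_prob 0 s) (shm c.1) \x
     distribution (normal_prob 0 s) (shm c.2))%E A.
  apply/esym/(@product_measure_unique _ _ _ _ _
    (distribution (normal_prob 0 s) (shm c.1)) (distribution (normal_prob 0 s) (shm c.2))
    (distribution (normal_prob 0 s \x normal_prob 0 s)%E trm)) => // B D mB mD.
  transitivity ((normal_prob 0 s \x normal_prob 0 s)%E
    ((sh c.1 @^-1` B) `*` (sh c.2 @^-1` D))) => //.
  by apply: product_measure1E; rewrite -[X in measurable X]setTI; exact: (msh _ measurableT).
rewrite expr2; apply: le_product_measure => // B mB; exact: normal_prob_shift_le.
Qed.

(** The order of quantifiers matters: [C] is fixed before the block length [T], and [Q] before the
    shifts [c]. All signals within [rho] of each other thus look alike up to [C ^+ T]. *)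
Lemma noisy_law_le (R : realType) (rho : R) : exists C : R, 1 <= C /\ forall T : nat,
  exists Q : probability (T.-tuple (R * R)) R,
    forall d (Om : measurableType d) (Pr : probability Om R)
      (Z : nat -> {RV Pr >-> (R * R)%type}) (c : nat -> R * R),
      iid CN01 Z -> (forall t, `|(c t).1| <= rho /\ `|(c t).2| <= rho) ->
      forall A, measurable A ->
        (Pr (slots T (fun t => translate (c t) \o Z t) @^-1` A) <= (C ^+ T)%:E * Q A)%E.
Proof.
set C := (Num.sqrt 2 * expR (rho ^+ 2)) ^+ 2.
exists C; split.
  rewrite -[leLHS](expr1n _ 2) lerXn2r ?nnegrE ?mulr_ge0 ?expR_ge0//.
  rewrite -[leLHS]mulr1 ler_pM//; last by rewrite -expR0 ler_expR sqr_ge0.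
  by rewrite -[leLHS]sqrtr1 ler_sqrt// ler1n.
move=> T.
have C_ge0 : 0 <= C by exact: sqr_ge0.
(* [normal_prob] lives on [measurableTypeR R], which has the same measurable sets
   as [R] but another display; [toRRm] transports the product law. *)
pose RR : measurableType _ := (measurableTypeR R * measurableTypeR R)%type.
pose toRR : RR -> (R * R)%type := id.
have mtoRR : measurable_fun setT toRR by move=> _ B mB; rewrite setTI; exact: mB.
pose toRRm : {mfun RR >-> (R * R)%type} :=
  HB.pack toRR (isMeasurableFun.Build _ _ _ _ toRR mtoRR).
have [Q domQ] := slots_law_le
  (distribution (normal_prob (0 : R) 1 \x normal_prob (0 : R) 1)%E toRRm) T C_ge0.
exists Q => d Om Pr Z c iidZ c_le A mA.
have CN01_fin (B : set (R * R)) : measurable B -> CN01 B \is a fin_num.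
  pose N1 : probability (measurableTypeR R) R := normal_prob (0 : R) (Num.sqrt 2^-1).
  pose N2 : probability RR R := (N1 \x N1)%E.
  by move=> mB; exact: (fin_num_measure N2 B mB).
have law1 t B : measurable B -> Pr (Z t @^-1` B) = CN01 B.
  move=> mB.
  have := iidZ [:: t] (fun=> B) isT (fun=> mB).
  rewrite big_seq1 set_cons1 bigcap_set1 => ->; rewrite fineK//; exact: CN01_fin.
have mX t : measurable_fun setT (translate (c t) \o Z t).
  by apply: measurableT_comp; [exact: measurable_translate|exact: measurable_funP].
have mtr t B : measurable B -> measurable (translate (c t) @^-1` B).
  by move=> mB; rewrite -[_ @^-1` _]setTI; apply: measurable_translate.
apply: domQ => //.
- move=> B mB.
  have := iidZ (iota 0 T) (fun t => translate (c t) @^-1` B t) (iota_uniq _ _)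
    (fun t => mtr t _ (mB t)).
  rewrite (_ : \bigcap_(i in _) _ =
      \bigcap_(i < T) (translate (c i) \o Z i) @^-1` B i); last first.
    apply/seteqP; split=> x Bx i /= => [iT|]; last rewrite mem_iota => /andP[_ iT];
      by apply: Bx => //=; rewrite mem_iota.
  move=> ->; rewrite -prodEFin.
  rewrite -{1}[T]subn0 -/(index_iota 0 T) big_mkord; apply: eq_bigr => i _.
  rewrite comp_preimage law1; last exact: mtr.
  by rewrite fineK//; apply: CN01_fin; exact: mtr.
- move=> t B mB; rewrite comp_preimage law1; last exact: mtr.
  by have [? ?] := c_le t; exact: CN01_translate_le.
Qed.

(** * Rounding under an energy constraint *)

(** The index is a sign and a modulus below [B]. With [s = sqrt P], [exp (1 / s) >= 1 + 1 / s] gives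
    a geometric series of sum at most [1 + s <= 2 s] for each sign, uniformly in [B]. *)
Lemma sum_geometric_weight (R : realType) (P : R) (B : nat) : 1 <= P ->
  \sum_(x : bool * 'I_B) expR (- (Num.sqrt P)^-1) ^+ x.2 <= 4 * Num.sqrt P.
Proof.
move=> P_ge1; set s := Num.sqrt P.
have s_ge1 : 1 <= s by rewrite -[leLHS]sqrtr1; exact: ler_wsqrtr.
have s_gt0 : 0 < s by exact: lt_le_trans s_ge1.
set th := expR _.
have th_ge0 : 0 <= th by exact: expR_ge0.
have th_le : th <= s / (1 + s).
  rewrite /th expRN -[leRHS]invrK lef_pV2 ?posrE ?expR_gt0 ?invr_gt0 ?divr_gt0 ?addr_gt0//.
  rewrite invf_div mulrDl mul1r divff ?gt_eqF// addrC; exact: expR_ge1Dx.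
have th_lt1 : s^-1 <= (1 + s^-1) * (1 - th).
  have : (1 + s^-1) * th <= 1.
    have -> : 1 + s^-1 = (1 + s) / s by rewrite mulrDl mul1r divff ?gt_eqF// addrC.
    by rewrite -ler_pdivlMl ?divr_gt0 ?addr_gt0// invf_div mulr1.
  by rewrite mulrBr mulr1; lra.
have th1 : 0 < 1 - th.
  have : 0 < (1 + s^-1) * (1 - th) by apply: lt_le_trans th_lt1; rewrite invr_gt0.
  by rewrite pmulr_rgt0// addr_gt0 ?invr_gt0.
rewrite -(pair_bigA _ (fun (_ : bool) (i : 'I_B) => th ^+ i)) /= big_bool /=.
have geo : \sum_(i < B) th ^+ i <= 2 * s.
  have sum_le : (1 - th) * \sum_(i < B) th ^+ i <= 1.
    by rewrite -[1 - th]opprB mulNr -subrX1 opprB gerBl exprn_ge0.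
  rewrite -(ler_pM2l th1) (le_trans sum_le)//.
  have : s * s^-1 <= s * ((1 + s^-1) * (1 - th)) by rewrite ler_pM2l.
  have -> : s * s^-1 = 1 by rewrite divff ?gt_eqF.
  have -> : s * ((1 + s^-1) * (1 - th)) = (s + s * s^-1) * (1 - th) by ring.
  rewrite divff ?gt_eqF// => /le_trans; apply.
  by rewrite mulrC ler_pM2l//; lra.
lra.
Qed.

(* [v w] is rounded to an integer vector [g].  Instead of counting the possible
   [g], each is given the weight
   [prod_j exp (- |g j| / sqrt P)], which the energy bound keeps above
   [exp (- (c + 1) / 2 * #|J|)] and whose total is at most [(4 sqrt P) ^ #|J|]. *)
Lemma quantized_sum_le (R : realType) (J W : finType) (P c S : R) (G : pred W)
    (v : W -> J -> R) (F : W -> R) (Phi : (J -> R) -> W -> R) :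
  1 <= P ->
  (forall g w, 0 <= Phi g w) ->
  (forall g, \sum_w Phi g w <= S) ->
  (forall w, G w -> \sum_j v w j ^+ 2 <= c * #|J|%:R * P) ->
  (forall w g, G w -> (forall j, `|v w j - g j| <= 1) -> F w <= Phi g w) ->
  \sum_(w | G w) F w <= S * (expR ((c + 1) / 2) * (4 * Num.sqrt P)) ^+ #|J|.
Proof.
move=> P_ge1 Phi_ge0 Phi_le v_le F_le.
set s := Num.sqrt P.
have s_ge1 : 1 <= s by rewrite -[leLHS]sqrtr1; exact: ler_wsqrtr.
have s_gt0 : 0 < s by exact: lt_le_trans s_ge1.
(* [B] exceeds every truncated modulus and only makes the set of lattice points finite; the final
   bound does not contain it. *)
pose B := (\max_(w : W) \max_(j : J) Num.truncn `|v w j|).+1.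
pose center (f : {ffun J -> bool * 'I_B}) j : R := (-1) ^+ (f j).1 * ((f j).2 : nat)%:R.
pose th : R := expR (- s^-1).
pose weight (f : {ffun J -> bool * 'I_B}) : R := \prod_j th ^+ (f j).2.
pose E : R := expR ((c + 1) / 2) ^+ #|J|.
have weight_ge0 f : 0 <= weight f by apply: prodr_ge0 => j _; rewrite exprn_ge0// expR_ge0.
have E_ge0 : 0 <= E by rewrite exprn_ge0// expR_ge0.
have S_ge0 : 0 <= S.
  by apply: le_trans (Phi_le (fun=> 0)); apply: sumr_ge0.
have B_gt w j : (Num.truncn `|v w j| < B)%N.
  by rewrite ltnS (leq_trans _ (leq_bigmax w))// (leq_bigmax j).
have quant w : G w -> F w <= E * \sum_f weight f * Phi (center f) w.
  move=> Gw.
  (* Rounding towards zero, as sign and integer part of the modulus. The single term at this [f]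
     already dominates [F w]. *)
  pose f : {ffun J -> bool * 'I_B} := [ffun j => (v w j < 0, Ordinal (B_gt w j))].
  have close j : `|v w j - center f j| <= 1.
    have -> : v w j = (-1) ^+ (v w j < 0)%R * `|v w j| by exact: realEsign (num_real _).
    rewrite /center ffunE /= -mulrBr normrM normrX normrN1 expr1n mul1r.
    have := truncn_itv (normr_ge0 (v w j)); rewrite -natr1 => /andP[h1 h2].
    by rewrite ger0_norm ?subr_ge0// lerBlDr addrC ltW.
  apply: (le_trans (F_le _ _ Gw close)).
  rewrite (bigD1 f)//= mulrDr -[leLHS]addr0 lerD//; last first.
    by rewrite mulr_ge0// sumr_ge0// => f' _; rewrite mulr_ge0.
  rewrite mulrA -[leLHS]mul1r ler_wpM2r//.
  have -> : weight f = expR (\sum_j (f j).2%:R * - s^-1).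
    by rewrite expR_sum; apply: eq_bigr => j _; rewrite expRM_natl.
  rewrite /E -expRM_natl -expRD -[leLHS]expR0 ler_expR.
  (* With [a = |v w j| / s], [a <= (a^2 + 1) / 2] turns the energy bound into a lower bound on the
     weight. *)
  apply: (@le_trans _ _ (#|J|%:R * ((c + 1) / 2) - \sum_j (v w j ^+ 2 / P + 1) / 2)).
    rewrite subr_ge0 -mulr_suml big_split /= -mulr_suml sumr_const.
    rewrite mulrA ler_pM2r ?invr_gt0// mulrDr mulr1 lerD2r.
    by rewrite ler_pdivrMr ?(lt_le_trans ltr01)// mulrC [_ * c]mulrC mulrC v_le.
  rewrite lerD2l -sumrN; apply: ler_sum => j _; rewrite mulrN lerN2 ffunE /=.
  have Ps : P = s ^+ 2 by rewrite sqr_sqrtr// (le_trans ler01).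
  apply: (@le_trans _ _ (`|v w j| / s)); first by rewrite ler_pM2r ?invr_gt0 ?truncn_le.
  have := sqr_ge0 (`|v w j| / s - 1).
  by rewrite Ps -(real_normK (num_real (v w j))) -exprVn -exprMn; nra.
apply: (@le_trans _ _ (\sum_w E * \sum_f weight f * Phi (center f) w)).
  rewrite big_mkcond /=; apply: ler_sum => w _; case: ifP => [/quant//|_].
  by rewrite mulr_ge0// sumr_ge0// => f' _; rewrite mulr_ge0.
(* After exchanging sums, [S] bounds each inner sum over [w], and the total weight factors over the
   coordinates. *)
rewrite -mulr_sumr exchange_big /=.
under eq_bigr do rewrite -mulr_sumr.
apply: (@le_trans _ _ (E * \sum_f weight f * S)).
  by rewrite ler_wpM2l// ler_sum// => f _; rewrite ler_wpM2l.
rewrite -mulr_suml exprMn -/E mulrC -mulrA mulrCA ler_wpM2l// mulrC ler_wpM2l//.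
rewrite /weight -(bigA_distr_bigA (fun (j : J) (x : bool * 'I_B) => th ^+ x.2)) prodr_const.
apply: lerXn2r; rewrite ?nnegrE ?mulr_ge0 ?(ltW s_gt0)//.
  by apply: sumr_ge0 => x _; rewrite exprn_ge0// expR_ge0.
exact: (sum_geometric_weight B P_ge1).
Qed.

(** * Counting and averaging over libraries *)

(** The sum factors over the files. By injectivity a demanded file belongs to one user and
    contributes at most [1]; every other file contributes [n]. *)
Lemma sum_prod_demanded_le (R : realType) (K N n : nat) (D : 'I_K -> 'I_N)
    (h : 'I_K -> 'I_n -> R) :
  injective D -> (forall k f, 0 <= h k f) -> (forall k, \sum_f h k f <= 1) ->
  (\sum_(w : {ffun 'I_N -> 'I_n}) \prod_k h k (w (D k))) * n%:R ^+ K <= n%:R ^+ N.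
Proof.
move=> injD h_ge0 h_le1.
pose H (i : 'I_N) (f : 'I_n) := \prod_(k | D k == i) h k f.
have -> : \sum_(w : {ffun 'I_N -> 'I_n}) \prod_k h k (w (D k)) = \prod_i \sum_f H i f.
  rewrite bigA_distr_bigA; apply: eq_bigr => w _.
  rewrite [LHS](partition_big D xpredT)//=; apply: eq_bigr => i _; rewrite /H.
  by apply: eq_bigr => k /eqP ->.
have -> : n%:R ^+ K = \prod_(i : 'I_N) \prod_(k : 'I_K | D k == i) n%:R :> R.
  transitivity (\prod_(k < K) n%:R : R); first by rewrite prodr_const card_ord.
  exact: partition_big.
have -> : n%:R ^+ N = \prod_(i : 'I_N) n%:R :> R by rewrite prodr_const card_ord.
rewrite -big_split /=; apply: ler_prod => i _; apply/andP; split.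
  rewrite mulr_ge0 ?prodr_ge0// sumr_ge0// => f _.
  by apply: prodr_ge0 => k _; exact: h_ge0.
have [k0 /eqP Dk0|noD] := pickP [pred k | D k == i].
  have DE : [pred k | D k == i] =1 pred1 k0 by move=> k /=; rewrite -Dk0 (inj_eq injD).
  rewrite (big_pred1 k0)// ler_piMl//.
  by under eq_bigr do rewrite /H (big_pred1 k0)//; exact: h_le1.
rewrite [X in _ * X]big_pred0// mulr1.
by under eq_bigr do rewrite /H big_pred0//; rewrite sumr_const card_ord.
Qed.

(** Markov's inequality at four times the bound on the mean. The case [B = 0] is separate because
    [B] cannot be cancelled; there every [e w] vanishes. *)
Lemma card_gt_mean_le (R : realType) (W : finType) (e : W -> R) (B : R) :
  0 <= B -> (forall w, 0 <= e w) -> \sum_w e w <= B * #|W|%:R ->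
  4 * #|[pred w | ~~ (e w <= 4 * B)]|%:R <= #|W|%:R :> R.
Proof.
move=> B_ge0 e_ge0 sum_le; have [B0|B_neq0] := eqVneq B 0.
  have e0 : forall w, e w = 0.
    move: sum_le; rewrite B0 mul0r => sum_le w; apply/eqP; rewrite eq_le e_ge0 andbT.
    by apply: le_trans sum_le; rewrite (bigD1 w)//= lerDl sumr_ge0.
  by rewrite eq_card0 ?mulr0// => w; rewrite inE e0 B0 mulr0 lexx.
have B_gt0 : 0 < B by rewrite lt_neqAle eq_sym B_neq0.
rewrite -(ler_pM2l B_gt0) (le_trans _ sum_le)//.
rewrite (bigID [pred w | ~~ (e w <= 4 * B)])/= -[leLHS]addr0 lerD ?sumr_ge0//.
have -> : B * (4 * #|[pred w | ~~ (e w <= 4 * B)]|%:R) =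
    \sum_(w in [pred w | ~~ (e w <= 4 * B)]) 4 * B.
  by rewrite sumr_const -mulr_natr; ring.
by apply: ler_sum => w; rewrite inE -ltNge => /ltW.
Qed.

(** Weierstrass product inequality; the induction also carries that the partial products stay in
    [[0, 1]]. *)
Lemma prod_ge_1Bsum (R : realType) (I : finType) (s : I -> R) :
  (forall i, 0 <= s i <= 1) -> 1 - \sum_i (1 - s i) <= \prod_i s i.
Proof.
move=> s01; suff : forall r : seq I, 0 <= \prod_(i <- r) s i <= 1 /\
    1 - \sum_(i <- r) (1 - s i) <= \prod_(i <- r) s i.
  by move=> /(_ (index_enum I))[].
elim=> [|i r [/andP[p0 p1] IH]]; first by rewrite !big_nil ler01 lexx subr0.
have /andP[s0 s1] := s01 i.
by rewrite !big_cons; split; [rewrite mulr_ge0//= mulr_ile1|nra].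
Qed.

(** * Size of codes over a fixed linear Gaussian channel *)

Lemma Re_sum (R : rcfType) (I : Type) (r : seq I) (P : pred I) (F : I -> R[i]) :
  complex.Re (\sum_(i <- r | P i) F i) = \sum_(i <- r | P i) complex.Re (F i).
Proof. by apply: (big_morph (@complex.Re R)) => // -[a b] [c e]. Qed.

Lemma Im_sum (R : rcfType) (I : Type) (r : seq I) (P : pred I) (F : I -> R[i]) :
  complex.Im (\sum_(i <- r | P i) F i) = \sum_(i <- r | P i) complex.Im (F i).
Proof. by apply: (big_morph (@complex.Im R)) => // -[a b] [c e]. Qed.

(** [A] and the width [q] are left free, so that either the edge signals or the noiseless outputs
    can serve as input. *)
Definition noisy_output (R : realType) (K q T : nat) (A : 'M[R[i]]_(K, q))
    (u : nat -> 'I_q -> R[i]) (k : 'I_K) (z : nat -> R * R) : T.-tuple (R * R) :=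
  [tuple of_complex (\sum_(j < q) A k j * u t j + to_complex (z t)) | t < T].

Lemma measurable_noisy_output (R : realType) (K q T : nat) (A : 'M[R[i]]_(K, q))
    (u : nat -> 'I_q -> R[i]) (k : 'I_K) d (Om : measurableType d) (Pr : probability Om R)
    (Z : nat -> {RV Pr >-> (R * R)%type}) :
  measurable_fun setT (fun x => noisy_output T A u k (fun t => Z t x)).
Proof.
pose s t : R * R := of_complex (\sum_(j < q) A k j * u t j).
rewrite (_ : (fun x => _) = slots T (fun t => translate (s t) \o Z t)).
  apply: measurable_slots => t.
  by apply: measurableT_comp; [exact: measurable_translate|exact: measurable_funP].
apply/funext => x; apply: eq_from_tnth => t; rewrite !tnth_mktuple /=.
rewrite /s /of_complex /to_complex /translate.
by case: (\sum_j _ : R[i]) => [a b] /=; congr (_, _); rewrite addrC.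
Qed.

(** The product of the users' success probabilities, summed over the low-energy [w], is estimated
    twice. Small error makes it at least [n^N / 2]; rounding and the disjoint decoding regions make
    it at most [n^(N - K) (Gamma P^q)^T]. *)
Lemma code_size_le (R : realType) (K q : nat) (A : 'M[R[i]]_(K, q)) (c : R)
    dZ (OmZ : measurableType dZ) (PrZ : probability OmZ R)
    (Z : 'I_K * nat -> {RV PrZ >-> (R * R)%type}) :
  (0 < q)%N -> 0 <= c -> iid CN01 Z ->
  exists Gamma : R, 1 <= Gamma /\
  forall (N n T : nat) (D : 'I_K -> 'I_N)
    (u : {ffun 'I_N -> 'I_n} -> nat -> 'I_q -> R[i])
    (dec : 'I_K -> 'I_n -> set (T.-tuple (R * R))) (P : R),
  (0 < n)%N -> injective D -> 1 <= P ->
  (forall k f, measurable (dec k f)) ->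
  (forall k, trivIset setT (dec k)) ->
  \sum_w \sum_(t < T) \sum_j (complex.Re (u w t j) ^+ 2 + complex.Im (u w t j) ^+ 2)
    <= c * T%:R * P * #|{ffun 'I_N -> 'I_n}|%:R ->
  \sum_(w : {ffun 'I_N -> 'I_n}) \sum_k (1 - fine (PrZ [set x | dec k (w (D k))
      (noisy_output T A (u w) k (fun t => Z (k, t) x))])) <= #|{ffun 'I_N -> 'I_n}|%:R / 4 ->
  n%:R ^+ K <= 2 * (Gamma * P ^+ q) ^+ T.
Proof.
move=> q_gt0 c_ge0 iidZ.
(* [rho] bounds the change of any output coordinate when each real input coordinate moves by at most
   [1]. *)
pose rho : R := \sum_k \sum_j (`|complex.Re (A k j)| + `|complex.Im (A k j)|).
have rho_ge k : \sum_j (`|complex.Re (A k j)| + `|complex.Im (A k j)|) <= rho.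
  rewrite /rho (bigD1 k)//= lerDl sumr_ge0// => k' _.
  by apply: sumr_ge0 => j _; rewrite addr_ge0.
have rho_ge0 : 0 <= rho.
  by apply: sumr_ge0 => k _; apply: sumr_ge0 => j _; rewrite addr_ge0.
have iidZk k : iid CN01 (fun t => Z (k, t)).
  move=> I B uI mB.
  have uI' : uniq [seq (k, t) | t <- I] by rewrite map_inj_uniq// => ? ? [].
  have := iidZ _ (fun kt => B kt.2) uI' (fun kt => mB kt.2).
  rewrite big_map /= => <-; congr (PrZ _); apply/seteqP; split=> x /= Bx.
    by move=> [k' t] /= /mapP[t' t'I [-> ->]]; exact: Bx.
  by move=> t /= tI; apply: (Bx (k, t)); rewrite /= map_f.
have [C [C_ge1 CP]] := noisy_law_le rho.
have C_ge0 : 0 <= C by exact: le_trans C_ge1.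
(* The constant of [quantized_sum_le] for energy [4 * c], the factor [4] coming from Markov's
   inequality. *)
pose kap : R := expR ((4 * c + 1) / 2) * 4.
have kap_ge1 : 1 <= kap.
  have : 1 <= expR ((4 * c + 1) / 2).
    by rewrite -[leLHS]expR0 ler_expR divr_ge0// addr_ge0// mulr_ge0.
  by rewrite /kap; lra.
exists (C ^+ K * (kap ^+ 2) ^+ q); split.
  by rewrite mulr_ege1// !exprn_ege1.
move=> N n T D u dec P n_gt0 injD P_ge1 mdec tdec energy_le error_le.
have P_ge0 : 0 <= P by exact: le_trans P_ge1.
have [Q QP] := CP T.
pose s (w : {ffun 'I_N -> 'I_n}) k := fine (PrZ [set x | dec k (w (D k))
      (noisy_output T A (u w) k (fun t => Z (k, t) x))]).
pose e (w : {ffun 'I_N -> 'I_n}) :=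
  \sum_(t < T) \sum_j (complex.Re (u w t j) ^+ 2 + complex.Im (u w t j) ^+ 2).
pose B := c * T%:R * P.
have B_ge0 : 0 <= B by rewrite !mulr_ge0.
pose G : pred {ffun 'I_N -> 'I_n} := [pred w | e w <= 4 * B].
pose J : finType := ('I_T * 'I_q * bool)%type.
pose v (w : {ffun 'I_N -> 'I_n}) (j : J) : R :=
  if j.2 then complex.Re (u w j.1.1 j.1.2) else complex.Im (u w j.1.1 j.1.2).
pose gu (g : J -> R) (t : nat) (j : 'I_q) : R[i] :=
  if insub t is Some i then (g (i, j, true) +i* g (i, j, false))%C else 0.
pose b (g : J -> R) k t : R * R := of_complex (\sum_(j < q) A k j * gu g t j).
pose a w k t : R * R := of_complex (\sum_(j < q) A k j * u w t j).
(* Translating by the output of the lattice point [g] leaves only the bounded residual shift [cc].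
   The decoding regions, pulled back along [tb], remain disjoint. *)
pose tb g k (y : T.-tuple (R * R)) : T.-tuple (R * R) :=
  [tuple translate (b g k t) (tnth y t) | t < T].
have mtb g k : measurable_fun setT (tb g k).
  apply/measurable_fun_tnthP => i.
  rewrite (_ : _ \o _ = translate (b g k i) \o (@tnth _ _ ^~ i)); last first.
    by apply/funext => y; rewrite /= tnth_mktuple.
  by apply: measurableT_comp; [exact: measurable_translate|exact: measurable_tnth].
pose Qg g k f : R := fine (Q (tb g k @^-1` dec k f)).
have mtbd g k f : measurable (tb g k @^-1` dec k f).
  by rewrite -[_ @^-1` _]setTI; exact: (mtb g k measurableT).
have Qg_ge0 g k f : 0 <= Qg g k f by exact: fine_ge0.
have Qg_sum g k : \sum_f Qg g k f <= 1.
  have mU : measurable (\big[setU/set0]_(f < n) (tb g k @^-1` dec k f)).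
    by apply: bigsetU_measurable => f _.
  rewrite -lee_fin -sumEFin.
  under eq_bigr do rewrite fineK ?fin_num_measure//.
  rewrite -measure_semi_additive_ord//; first exact: probability_le1.
  apply/trivIsetP => f1 f2 _ _ f12; rewrite -preimage_setI.
  by have /trivIsetP -> := tdec k; rewrite ?preimage_set0.
(* Replacing the joint success probability by the product of the marginal ones
   costs nothing: the union bound [1 - sum (1 - s) <= prod s] holds for it too. *)
pose Phi g (w : {ffun 'I_N -> 'I_n}) := \prod_k (C ^+ T * Qg g k (w (D k))).
have Phi_ge0 g w : 0 <= Phi g w.
  by apply: prodr_ge0 => k _; rewrite mulr_ge0// exprn_ge0.
have Phi_sum g : \sum_w Phi g w <= (C ^+ T) ^+ K * n%:R ^+ N / n%:R ^+ K.
  rewrite ler_pdivlMr ?exprn_gt0 ?ltr0n//.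
  under eq_bigr do rewrite /Phi big_split /= prodr_const card_ord.
  rewrite -mulr_sumr -mulrA ler_wpM2l ?exprn_ge0//.
  exact: sum_prod_demanded_le.
(* The value [0] beyond the block keeps the shift bounded at every [t], as [noisy_law_le] asks. *)
pose cc g w k t : R * R := if (t < T)%N then a w k t - b g k t else 0.
have outE g w k x : noisy_output T A (u w) k (fun t => Z (k, t) x) =
    tb g k (slots T (fun t => translate (cc g w k t) \o Z (k, t)) x).
  apply: eq_from_tnth => t; rewrite !tnth_mktuple /= /cc ltn_ord.
  rewrite /of_complex /to_complex /translate /= /a.
  move: (\sum_j _ : R[i]) (b g k t) => [a1 a2] [b1 b2] /=.
  by congr (_, _); ring.
pose ok (w : {ffun 'I_N -> 'I_n}) k : set OmZ :=
  [set x | dec k (w (D k)) (noisy_output T A (u w) k (fun t => Z (k, t) x))].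
have okE g w k : ok w k = slots T (fun t => translate (cc g w k t) \o Z (k, t)) @^-1`
    (tb g k @^-1` dec k (w (D k))).
  by apply/seteqP; split=> x; rewrite /ok /= (outE g).
have mok w k : measurable (ok w k).
  rewrite -[ok w k]setTI.
  have mout := @measurable_noisy_output R K q T A (u w) k _ _ PrZ (fun t => Z (k, t)).
  exact: (mout measurableT _ (mdec k _)).
have s01 w k : 0 <= s w k <= 1.
  rewrite -[s w k]/(fine (PrZ (ok w k))) fine_ge0//= -lee_fin.
  by rewrite (fineK (fin_num_measure _ _ (mok w k))) probability_le1.
have close w g k : (forall j, `|v w j - g j| <= 1) -> s w k <= C ^+ T * Qg g k (w (D k)).
  move=> vg; rewrite -[s w k]/(fine (PrZ (ok w k))) -lee_fin EFinM.
  rewrite (fineK (fin_num_measure _ _ (mok w k))) (fineK (fin_num_measure _ _ (mtbd g k _))).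
  rewrite (okE g); apply: QP => // t.
  rewrite /cc; case: ifPn => [tT|_]; last by rewrite /= normr0.
  pose t' := Ordinal tT.
  have guE j : gu g t j = (g (t', j, true) +i* g (t', j, false))%C.
    by rewrite /gu; case: insubP => [i _ ti|]; [have -> : i = t' by exact: val_inj|rewrite tT].
  have vre j : `|complex.Re (u w t j) - g (t', j, true)| <= 1 by exact: (vg (t', j, true)).
  have vim j : `|complex.Im (u w t j) - g (t', j, false)| <= 1 by exact: (vg (t', j, false)).
  rewrite /a /b /of_complex /= !Re_sum !Im_sum -!sumrB.
  split; apply: le_trans (rho_ge k); apply: (le_trans (ler_norm_sum _ _ _));
    apply: ler_sum => j _; rewrite guE; move: (vre j) (vim j); case: (A k j) (u w t j) => [x y] [p1 p2] /=;
    move: (g (t', j, true)) (g (t', j, false)) => g1 g2 h1 h2.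
    have -> : x * p1 - y * p2 - (x * g1 - y * g2) = x * (p1 - g1) - y * (p2 - g2) by ring.
    by rewrite (le_trans (ler_normB _ _))// !normrM lerD// ler_piMr.
  have -> : x * p2 + y * p1 - (x * g2 + y * g1) = x * (p2 - g2) + y * (p1 - g1) by ring.
  by rewrite (le_trans (ler_normD _ _))// !normrM lerD// ler_piMr.
(* High energy costs at most a quarter of the libraries and decoding errors another quarter; half
   remains. *)
have sum_ge : #|{ffun 'I_N -> 'I_n}|%:R / 2 <= \sum_(w | G w) \prod_k s w k.
  pose err (w : {ffun 'I_N -> 'I_n}) := \sum_k (1 - s w k).
  have err_ge0 w : 0 <= err w.
    by apply: sumr_ge0 => k _; rewrite subr_ge0; case/andP: (s01 w k).
  have e_ge0 w : 0 <= e w.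
    by apply: sumr_ge0 => t _; apply: sumr_ge0 => j _; rewrite addr_ge0 ?sqr_ge0.
  have := card_gt_mean_le B_ge0 e_ge0 energy_le; set cG := #|_|%:R => cG_le.
  apply: (@le_trans _ _ (\sum_(w | G w) (1 - err w))); last first.
    by apply: ler_sum => w _; apply: prod_ge_1Bsum.
  rewrite sumrB sumr_const.
  have -> : #|G|%:R = #|{ffun 'I_N -> 'I_n}|%:R - cG :> R.
    by rewrite -(cardC G) natrD addrK.
  have : \sum_(w | G w) err w <= #|{ffun 'I_N -> 'I_n}|%:R / 4.
    apply: le_trans error_le; rewrite [leRHS](bigID G)/= lerDl.
    by apply: sumr_ge0 => w _; exact: err_ge0.
  lra.
have := @quantized_sum_le R J {ffun 'I_N -> 'I_n} P (4 * c)
  ((C ^+ T) ^+ K * n%:R ^+ N / n%:R ^+ K) G v (fun w => \prod_k s w k)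
  Phi P_ge1 Phi_ge0 Phi_sum.
have cardJ : #|J| = (2 * q * T)%N.
  by rewrite !card_prod card_bool !card_ord mulnC mulnA mulnAC.
have G_le w : G w -> \sum_j v w j ^+ 2 <= 4 * c * #|J|%:R * P.
  move=> Gw; have -> : \sum_j v w j ^+ 2 = e w.
    rewrite /e pair_bigA /= -(pair_bigA _ (fun p (x : bool) => v w (p, x) ^+ 2))/=.
    by apply: eq_bigr => p _; rewrite big_bool.
  apply: (le_trans Gw); rewrite /B !mulrA cardJ ler_wpM2r// ler_wpM2l ?mulr_ge0//.
  by rewrite ler_nat leq_pmull// muln_gt0.
have F_le w g : G w -> (forall j, `|v w j - g j| <= 1) -> \prod_k s w k <= Phi g w.
  move=> Gw vg; apply: ler_prod => k _; rewrite close// andbT.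
  by case/andP: (s01 w k).
move=> /(_ G_le F_le) /(le_trans sum_ge).
have -> : expR ((4 * c + 1) / 2) * (4 * Num.sqrt P) = kap * Num.sqrt P by rewrite mulrA.
have -> : (kap * Num.sqrt P) ^+ #|J| = ((kap ^+ 2) ^+ q * P ^+ q) ^+ T.
  by rewrite cardJ exprM exprM [(kap * _) ^+ 2]exprMn (sqr_sqrtr P_ge0) [(_ * P) ^+ q]exprMn.
set Y := (_ * P ^+ q) ^+ T; set X := (C ^+ T) ^+ K.
have -> : (C ^+ K * (kap ^+ 2) ^+ q * P ^+ q) ^+ T = X * Y.
  by rewrite -mulrA [LHS]exprMn /X -[(C ^+ K) ^+ T]exprM -[(C ^+ T) ^+ K]exprM [(T * K)%N]mulnC.
rewrite card_ffun !card_ord natrX.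
have nN : 0 < n%:R ^+ N :> R by rewrite exprn_gt0// ltr0n.
have nK : 0 < n%:R ^+ K :> R by rewrite exprn_gt0// ltr0n.
have -> : X * n%:R ^+ N / n%:R ^+ K * Y = n%:R ^+ N * (X * Y / n%:R ^+ K) by ring.
by rewrite ler_pM2l// ler_pdivlMr//; lra.
Qed.

(** * Effective channel input of a policy *)

Definition sqr_modulus (R : realType) (z : R[i]) : R := complex.Re z ^+ 2 + complex.Im z ^+ 2.

Lemma sqr_modulus_ge0 (R : realType) (z : R[i]) : 0 <= sqr_modulus z.
Proof. by rewrite addr_ge0 ?sqr_ge0. Qed.

Lemma sqr_modulusM (R : realType) (x y : R[i]) :
  sqr_modulus (x * y) = sqr_modulus x * sqr_modulus y.
Proof. by case: x y => [a b] [c e]; rewrite /sqr_modulus /=; ring. Qed.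

Lemma sqr_modulus_sum_le (R : realType) (I : Type) (r : seq I) (F : I -> R[i]) :
  sqr_modulus (\sum_(i <- r) F i) <= 2 ^+ size r * \sum_(i <- r) sqr_modulus (F i).
Proof.
elim: r => [|i r IH]; first by rewrite !big_nil /sqr_modulus /= expr0n /= addr0 mulr0.
rewrite !big_cons /=.
have add_le (x y : R[i]) : sqr_modulus (x + y) <= 2 * sqr_modulus x + 2 * sqr_modulus y.
  case: x y => [a b] [c e]; rewrite /sqr_modulus /=.
  by have := sqr_ge0 (a - c); have := sqr_ge0 (b - e); nra.
apply: (le_trans (add_le _ _)); rewrite exprS [leRHS]mulrDr lerD//; last first.
  by rewrite -mulrA ler_pM2l.
by rewrite -mulrA ler_pM2l// ler_peMl ?sqr_modulus_ge0// exprn_ege1// ler1n.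
Qed.

(** An effective input [U] of [min(M, K)] coordinates, of energy controlled by the edge powers,
    reproduces all noiseless outputs, so [code_size_le] applies. The error threshold, summed over
    [K] users, gives the budget [1/4]. *)
Lemma policy_size_le (R : realType) (M K N : nat) (H : 'M[R[i]]_(K, M))
    dZ (OmZ : measurableType dZ) (PrZ : probability OmZ R)
    (Z : 'I_K * nat -> {RV PrZ >-> (R * R)%type}) :
  (0 < M)%N -> (0 < K)%N -> (K <= N)%N -> iid CN01 Z ->
  exists Gamma : R, 1 <= Gamma /\
  forall (L : nat) (p : policy M K N L) (mu r P : R),
    1 <= P -> admissible p mu r P -> error_probability p Z H <= (4 * K%:R)^-1 ->
    (2 ^ L)%:R ^+ K <= 2 * (Gamma * P ^+ minn M K) ^+ latency p.
Proof.
move=> M_gt0 K_gt0 le_KN iidZ.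
pose eta : R := \sum_k \sum_m sqr_modulus (H k m).
have eta_ge0 : 0 <= eta.
  by apply: sumr_ge0 => k _; apply: sumr_ge0 => m _; exact: sqr_modulus_ge0.
suff [q [A [c [U [qE [c_ge0 [U_le UE]]]]]]] : exists q (A : 'M[R[i]]_(K, q)) (c : R)
    (U : ('I_M -> R[i]) -> 'I_q -> R[i]),
    q = minn M K /\ 0 <= c /\
    (forall x, \sum_j sqr_modulus (U x j) <= c * \sum_m sqr_modulus (x m)) /\
    (forall x k, \sum_j A k j * U x j = \sum_m H k m * x m).
  have q_gt0 : (0 < q)%N by rewrite qE leq_min M_gt0.
  have cM_ge0 : 0 <= c * M%:R by rewrite mulr_ge0.
  have [Gamma [Gamma_ge1 GammaP]] := code_size_le A q_gt0 cM_ge0 iidZ.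
  exists Gamma; split=> // L p mu r P P_ge1 [_ _ power_le mdec] err_le.
  (* Pairwise distinct demands, possible since [K <= N]. *)
  pose D : demand K N := [ffun k => widen_ord le_KN k].
  pose x w t m := edge_signal p D H w m t.
  pose dec k f := [set y | decoder (p := p) k y (D k) H = f].
  have nlib_gt0 : 0 < #|library N L|%:R :> R.
    by rewrite ltr0n card_ffun !card_ord expn_gt0 expn_gt0.
  rewrite -qE; apply: (GammaP N (2 ^ L)%N (latency p) D (fun w t => U (x w t)) dec P) => //.
  - by rewrite expn_gt0.
  - by move=> k1 k2; rewrite !ffunE => /(congr1 val) /= /val_inj.
  - by move=> k f; exact: mdec.
  - by move=> k f1 f2 _ _ [y [/= <- <-]].
  - have x_le m : \sum_w \sum_(t < latency p) sqr_modulus (x w t m) <=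
        (latency p)%:R * P * #|library N L|%:R.
      have := power_le D H m; rewrite /average_power.
      (* At latency [0] the factor [0^-1 = 0] makes the power bound uninformative, but the energy is
         an empty sum. *)
      have [->|T_gt0] := posnP (latency p).
        by move=> _; rewrite !mul0r big1// => w _; rewrite big_ord0.
      rewrite ler_pdivrMl ?ltr0n// -mulr_sumr ler_pdivrMl// exchange_big /= mulrC; exact.
    apply: (@le_trans _ _ (\sum_w \sum_(t < latency p) c * \sum_m sqr_modulus (x w t m))).
      by apply: ler_sum => w _; apply: ler_sum => t _; exact: U_le.
    under eq_bigr do rewrite -mulr_sumr exchange_big /=.
    rewrite -mulr_sumr exchange_big /= -!mulrA ler_wpM2l//.
    rewrite mulr_natl -[M in _ *+ M]card_ord -sumr_const.
    by apply: ler_sum => m _; rewrite mulrA.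
  - pose u (w : library N L) t := U (x w t).
    have outE w k z : received p Z D H w k z =
        noisy_output (latency p) A (u w) k (fun t => Z (k, t) z).
      by apply: eq_from_tnth => t; rewrite !tnth_mktuple UE.
    rewrite exchange_big /=.
    have user_le k : \sum_(w : library N L) (1 - fine (PrZ [set z | dec k (w (D k))
        (noisy_output (latency p) A (u w) k (fun t => Z (k, t) z))])) <=
        #|library N L|%:R * (4 * K%:R)^-1.
      have -> : \sum_(w : library N L) (1 - fine (PrZ [set z | dec k (w (D k))
          (noisy_output (latency p) A (u w) k (fun t => Z (k, t) z))])) =
          #|library N L|%:R * user_error p Z H D k.
        rewrite /user_error mulrA divff ?gt_eqF// mul1r; apply: eq_bigr => w _.
        set ok := [set z | dec _ _ _].
        have mok : measurable ok.
          rewrite -[ok]setTI.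
          have mout := @measurable_noisy_output R K q (latency p) A (u w) k _ _ PrZ
            (fun t => Z (k, t)).
          have := mout measurableT _ (mdec k (D k) H (w (D k))).
          exact.
        have -> : [set z | decoder k (received p Z D H w k z) (D k) H <> w (D k)] = ~` ok.
          by apply/seteqP; split=> z /=; rewrite outE.
        by rewrite probability_setC// fineB// fin_num_measure.
      rewrite ler_pM2l//; apply: le_trans err_le.
      apply: le_trans (le_bigmax _ _ D); exact: (le_bigmax _ _ k).
    apply: (le_trans (ler_sum _ (fun k _ => user_le k))).
    rewrite sumr_const card_ord -[_ *+ K]mulr_natr invfM -!mulrA.
    by rewrite mulVf ?mulr1// pnatr_eq0 -lt0n.
(* The effective input is the vector of edge signals if [M <= K], and the vector
   of noiseless outputs otherwise. *)
have [leMK|ltKM] := leqP M K.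
  exists M, H, 1, (fun x => x); split; [|split; [|split]] => //.
  - by move=> x; rewrite mul1r.
exists K, 1%:M, (K%:R * 2 ^+ M * eta), (fun x k => \sum_m H k m * x m).
split; [|split; [|split]] => //.
- by rewrite !mulr_ge0// exprn_ge0.
- move=> x.
  rewrite -!mulrA -[leRHS]/(K%:R * _) mulr_natl -[K in _ *+ K]card_ord -sumr_const.
  apply: ler_sum => k _; apply: (le_trans (sqr_modulus_sum_le _ _)).
  rewrite /index_enum -enumT size_enum_ord ler_wpM2l ?exprn_ge0// mulr_sumr.
  rewrite enumT; apply: ler_sum => m _; rewrite sqr_modulusM ler_wpM2r ?sqr_modulus_ge0//.
  rewrite /eta (bigD1 k)//= (bigD1 m)//= -addrA lerDl addr_ge0// ?sumr_ge0// => [m' _|k' _].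
    exact: sqr_modulus_ge0.
  by rewrite sumr_ge0// => m' _; exact: sqr_modulus_ge0.
- move=> x k; rewrite (bigD1 k)//= mxE eqxx mul1r [X in _ + X]big1 ?addr0// => j jk.
  by rewrite mxE eq_sym (negbTE jk) mul0r.
Qed.

(** * From code size to the minimum NDT *)

Lemma latency_lower_bound (R : realType) (K q L T : nat) (Gamma P : R) :
  1 <= Gamma -> 1 <= P -> (2 ^ L)%:R ^+ K <= 2 * (Gamma * P ^+ q) ^+ T ->
  K%:R * L%:R <= 1 + T%:R * (log2 Gamma + q%:R * log2 P).
Proof.
move=> Gamma_ge1 P_ge1 size_le.
have Gamma_gt0 : 0 < Gamma by exact: lt_le_trans Gamma_ge1.
have P_gt0 : 0 < P by exact: lt_le_trans P_ge1.
have ln2_gt0 : 0 < ln (2 : R) by rewrite ln_gt0// ltr1n.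
have Pq_gt0 : 0 < P ^+ q by rewrite exprn_gt0.
have X_gt0 : 0 < (Gamma * P ^+ q) ^+ T by rewrite exprn_gt0// mulr_gt0.
move: size_le; rewrite natrX -exprM -ler_ln ?posrE ?exprn_gt0 ?mulr_gt0//.
rewrite [ln (2 * _)]lnM ?posrE// !lnXn ?mulr_gt0// lnM ?posrE// lnXn// => le_ln.
rewrite -(ler_pM2r ln2_gt0) mulrDl mul1r /log2.
have -> : T%:R * (ln Gamma / ln 2 + q%:R * (ln P / ln 2)) * ln 2 =
    T%:R * (ln Gamma + q%:R * ln P) :> R.
  by field; rewrite gt_eqF.
move: le_ln; rewrite -[ln 2 *+ (L * K)]mulr_natl natrM -[_ *+ T]mulr_natl -[_ *+ q]mulr_natl.
by rewrite [L%:R * K%:R]mulrC.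
Qed.

Lemma limn_esup_ge (R : realType) (u : nat -> \bar R) (l : \bar R) :
  (\forall n \near \oo, l <= u n)%E -> (l <= limn_esup u)%E.
Proof.
move=> ul; apply: le_ereal_inf_tmp => _ [V Voo <-].
have [n [ln Vn]] : exists n, (l <= u n)%E /\ V n.
  have : \forall n \near \oo, (l <= u n)%E /\ V n by apply: filterI ul Voo.
  by move=> /filter_ex[n ?]; exists n.
by apply: (le_trans ln); apply: ereal_sup_ubound; exists n.
Qed.

(** [latency_lower_bound] gives [T / L >= (K - 1 / L) / (log Gamma + q log P)]. Multiplied by
    [log P], this tends to [K / q] as first [L] and then [P] grows. *)
Lemma min_NDT_ge (R : realType) (M K N : nat)
    dH (OmH : measurableType dH) (PrH : probability OmH R)
    (h : 'I_K * 'I_M -> {RV PrH >-> (R * R)%type})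
    dZ (OmZ : measurableType dZ) (PrZ : probability OmZ R)
    (Z : 'I_K * nat -> {RV PrZ >-> (R * R)%type}) (mu r : R) :
  (0 < M)%N -> (0 < K)%N -> (K <= N)%N -> iid CN01 Z ->
  ((K%:R / (minn M K)%:R)%:E <= min_NDT N h Z mu r)%E.
Proof.
move=> M_gt0 K_gt0 le_KN iidZ; apply: le_ereal_inf_tmp => delta [pol [[A [_ feas]] pol_cvg]].
set q := minn M K.
have q_gt0 : 0 < q%:R :> R by rewrite ltr0n leq_min M_gt0.
(* [Gamma] depends on the channel, so one channel has to serve all powers;
   restricting to integer powers keeps the exceptional set negligible. *)
have [x good] : exists x, forall n : nat, A < n%:R ->
    (fun L => error_probability (pol n%:R L) Z (channel_matrix h x)) @ \oo --> (0 : R).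
  have : {ae PrH, forall x, forall n : nat, A < n%:R ->
    (fun L => error_probability (pol n%:R L) Z (channel_matrix h x)) @ \oo --> (0 : R)}.
    apply: ae_foralln => n; have [An|nAn] := boolP (A < n%:R).
      have [_] := feas _ An; apply: filterS => x cvgx _; exact: cvgx.
    by apply: filterE => x An; case/negP: nAn.
  have : ProperFilter (almost_everywhere PrH).
    by apply: ae_properfilter_algebraOfSetsType; rewrite [X in (_ < X)%E](probability_setT PrH).
  by move=> ae_proper /filter_ex.
have [Gamma [Gamma_ge1 size_le]] := policy_size_le (channel_matrix h x) M_gt0 K_gt0 le_KN iidZ.
apply/lee_subgt0Pr => e e_gt0; rewrite -EFinB.
set eta := K%:R / q%:R - e.
(* The slack [kap = e q] has to absorb both lower-order terms. *)
have kap_gt0 : 0 < K%:R - eta * q%:R.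
  have -> : K%:R - eta * q%:R = e * q%:R by rewrite /eta; field; rewrite gt_eqF.
  by rewrite mulr_gt0.
set kap := K%:R - eta * q%:R in kap_gt0.
have ln2_gt0 : 0 < ln (2 : R) by rewrite ln_gt0// ltr1n.
have lGamma_ge0 : 0 <= log2 Gamma by apply: divr_ge0; [exact: ln_ge0|exact: ltW].
have near_ge : \forall n \near \oo, (eta%:E <= limn_esup (fun L =>
    ((latency (pol n%:R L))%:R / (L%:R / log2 n%:R))%:E))%E.
  have lim_n : (fun n : nat => n%:R : R) @ \oo --> +oo by exact: cvgr_idn.
  have n_big B := (cvgryPge _).1 lim_n B.
  near=> n.
  have An : A < n%:R.
    apply: (@lt_le_trans _ _ (A + 1)); first by rewrite ltrDl.
    by near: n; exact: n_big.
  have n_ge2 : 2 <= n%:R :> R by near: n; exact: n_big.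
  (* Half of the slack absorbs [eta * log2 Gamma]; the modulus covers a negative [eta]. *)
  have n_ge : expR (ln 2 * (2 * `|eta| * log2 Gamma / kap)) <= n%:R by near: n; exact: n_big.
  have l_ge : 2 * `|eta| * log2 Gamma / kap <= log2 n%:R.
    rewrite /log2 ler_pdivlMr// mulrC -[leLHS]expRK ler_ln ?posrE ?expR_gt0//.
    by rewrite (lt_le_trans _ n_ge2).
  have l_gt0 : 0 < log2 (n%:R : R).
    by rewrite divr_gt0// ln_gt0// (lt_le_trans _ n_ge2)// ltr1n.
  apply: limn_esup_ge.
  have err_small : \forall L \near \oo,
      error_probability (pol n%:R L) Z (channel_matrix h x) <= (4 * K%:R)^-1.
    have c_gt0 : 0 < (4 * K%:R)^-1 :> R by rewrite invr_gt0 mulr_gt0// ltr0n.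
    have /cvgrPdist_le /(_ _ c_gt0) := good _ An.
    apply: filterS => L; rewrite sub0r normrN; exact: le_trans (ler_norm _).
  near=> L.
  (* The other half absorbs the additive [1] of [latency_lower_bound]. *)
  have L_ge : 2 / kap <= L%:R by near: L; exact: n_big.
  have L_gt0 : 0 < L%:R :> R by apply: lt_le_trans L_ge; rewrite divr_gt0.
  have n_ge1 : 1 <= n%:R :> R by apply: le_trans n_ge2; rewrite ler1n.
  have adm := (feas _ An).1 L.
  have err_le : error_probability (pol n%:R L) Z (channel_matrix h x) <= (4 * K%:R)^-1.
    by near: L.
  have := latency_lower_bound Gamma_ge1 n_ge1 (size_le _ _ _ _ _ n_ge1 adm err_le).
  rewrite lee_fin -/q; set T := (latency _)%:R => T_ge.
  rewrite invfM invrK mulrA -mulrAC ler_pdivlMr//.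
  set l := log2 n%:R in l_ge l_gt0 T_ge *.
  have den_gt0 : 0 < log2 Gamma + q%:R * l by rewrite ltr_wpDl// mulr_gt0.
  rewrite -(ler_pM2r den_gt0).
  move: l_ge L_ge; rewrite !ler_pdivrMr// => l_ge L_ge.
  have eta_le : eta * log2 Gamma <= `|eta| * log2 Gamma by rewrite ler_wpM2r// ler_norm.
  have l1 : kap * l / 2 <= kap * l - eta * log2 Gamma by lra.
  have l2 : l <= L%:R * (kap * l - eta * log2 Gamma).
    apply: (@le_trans _ _ (L%:R * (kap * l / 2))); last by rewrite ler_pM2l.
    have -> : L%:R * (kap * l / 2) = l * (L%:R * kap / 2) by ring.
    by rewrite -[leLHS]mulr1 ler_pM2l// ler_pdivlMr// mul1r.
  have -> : eta * L%:R * (log2 Gamma + q%:R * l) =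
      K%:R * L%:R * l - L%:R * (kap * l - eta * log2 Gamma).
    by rewrite /kap; ring.
  have := ler_wpM2r (ltW l_gt0) T_ge.
  by move: l2; lra.
(* The limit over real powers is also the limit along integer powers. *)
apply: (lee_cvg_to (cvg_cst eta%:E) (cvg_comp _ _ cvgr_idn pol_cvg)).
Unshelve. all: by end_near.
Qed.

(** * Corner points of the achievable NDT *)

Section CornerPoints.
Variables (R : realType) (M K : nat) (r : R).
Hypotheses (M_gt0 : (0 < M)%N) (K_gt0 : (0 < K)%N) (r_gt0 : 0 < r).

Let q : R := (minn M K)%:R.
Let s : R := (maxn M K)%:R.
Let m : R := M%:R.
Let k : R := K%:R.

Let bounds : [/\ 1 <= q, q <= s, q * s = k * m & q <= m <= s].
Proof.
rewrite /q /s /k /m ler1n leq_min M_gt0 K_gt0; split=> //.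
- by rewrite ler_nat (leq_trans (geq_minl _ _) (leq_maxl _ _)).
- by case: (leqP M K) => _; rewrite // mulrC.
- by rewrite !ler_nat geq_minl leq_maxl.
Qed.

(** Follows from [q s = k m]. It turns [1 - m r / q] into [(k - s r) / k], which has the numerator
    of [gap]. *)
Let load_eq : m * r / q = s * r / k.
Proof.
have [q_ge1 _ qs _] := bounds.
have q_neq0 : q != 0 by rewrite gt_eqF// (lt_le_trans _ q_ge1).
have k_neq0 : k != 0 by rewrite /k pnatr_eq0 -lt0n.
have -> : m = q * s / k by rewrite qs mulrAC divff ?mul1r.
by field; rewrite q_neq0 k_neq0.
Qed.

(** [mu1] before its positive part is taken. *)
Let gap : R := (k - s * r) / (k * m + m * r * (q - 1)).

Let gap_le : 0 < k - s * r -> gap <= 1 - m * r / q.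
Proof.
have [q_ge1 q_le_s qs /andP[q_le_m m_le_s]] := bounds.
have q_gt0 : 0 < q by exact: lt_le_trans q_ge1.
have m_gt0 : 0 < m by exact: lt_le_trans q_le_m.
have k_gt0 : 0 < k by rewrite /k ltr0n.
move=> gap_gt0.
have den_gt0 : 0 < k + r * (q - 1) by rewrite ltr_wpDr// mulr_ge0 ?subr_ge0// ltW.
have -> : gap = (k - s * r) / (m * (k + r * (q - 1))) by rewrite /gap; congr (_ / _); ring.
have -> : 1 - m * r / q = (k - s * r) / k by rewrite load_eq mulrBl divff ?gt_eqF.
rewrite ler_pM2l// lef_pV2 ?posrE ?mulr_gt0//.
have den_ge : k <= k + r * (q - 1) by rewrite lerDl mulr_ge0 ?subr_ge0// ltW.
by apply: (le_trans den_ge); rewrite ler_peMl ?(le_trans q_ge1)// ltW.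
Qed.

Lemma mu1_le_mu2 : mu1 M K r <= mu2 M K r <= 1.
Proof.
have [q_ge1 q_le_s qs /andP[q_le_m m_le_s]] := bounds.
have q_gt0 : 0 < q by exact: lt_le_trans q_ge1.
have m_gt0 : 0 < m by exact: lt_le_trans q_le_m.
have k_gt0 : 0 < k by rewrite /k ltr0n.
apply/andP; split; last first.
  by rewrite /mu2 ge_max ler01 gerBl divr_ge0 ?mulr_ge0 ?ltW.
rewrite /mu1 ge_max {1}/mu2 le_max lexx /= -/gap.
have [gap_gt0|gap_le0] := ltP 0 (k - s * r).
  by rewrite /mu2 le_max gap_le ?orbT.
apply: (@le_trans _ _ 0); last by rewrite /mu2 le_max lexx.
apply: mulr_le0_ge0 => //.
by rewrite invr_ge0 addr_ge0 ?mulr_ge0 ?subr_ge0 ?(ltW k_gt0) ?(ltW m_gt0) ?(ltW r_gt0).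
Qed.

(** Both [1 - mu2] and [1 - mu1 m] are at most [2 m r / q], hence so is their convex combination
    with weight [t]; the prefactor [k / (m r)] turns this into [2 k / q]. *)
Lemma NDT_ach_le mu : mu1 M K r <= mu <= mu2 M K r ->
  NDT_ach M K mu r <= 2 * (k / q).
Proof.
have [q_ge1 q_le_s qs /andP[q_le_m m_le_s]] := bounds.
have q_gt0 : 0 < q by exact: lt_le_trans q_ge1.
have m_gt0 : 0 < m by exact: lt_le_trans q_le_m.
have k_gt0 : 0 < k by rewrite /k ltr0n.
move=> /andP[mu1_le mu_le]; rewrite /NDT_ach -/k -/q -/m; case: ifPn => [mu_lt|_]; last first.
  by rewrite ler_peMl ?ler1n// ltW// divr_gt0.
have mu2_ge : 1 - mu2 M K r <= 2 * (m * r / q).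
  have : 1 - m * r / q <= mu2 M K r by rewrite /mu2 le_max lexx orbT.
  have : 0 < m * r / q by rewrite divr_gt0 ?mulr_gt0.
  lra.
have mu1_ge : 1 - mu1 M K r * m <= 2 * (m * r / q).
  have gap_mu1 : gap <= mu1 M K r by rewrite /mu1 le_max lexx orbT.
  have den_gt0 : 0 < k + r * (q - 1) by rewrite ltr_wpDr// mulr_ge0 ?subr_ge0// ltW.
  apply: (@le_trans _ _ (1 - gap * m)); first by rewrite lerD2l lerN2 ler_pM2r.
  have -> : 1 - gap * m = r * (q + s - 1) / (k + r * (q - 1)).
    rewrite /gap; field; rewrite gt_eqF// gt_eqF//=; nra.
  rewrite load_eq ler_pdivrMr// mulrA mulrAC ler_pdivlMr//.
  have s_ge0 : 0 <= s by exact: le_trans (ltW q_gt0) q_le_s.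
  (* After cross-multiplication, right side minus left side is this term plus twice the one in
     [sr_ge0]. *)
  have cross_ge0 : 0 <= r * k * (s - q + 1).
    apply: mulr_ge0; first by rewrite mulr_ge0// ltW.
    by lra.
  have sr_ge0 : 0 <= s * r * (r * (q - 1)) by rewrite !mulr_ge0 ?subr_ge0// ltW.
  by lra.
set t := (mu2 M K r - mu) / _.
have t_ge0 : 0 <= t by rewrite divr_ge0// subr_ge0// (le_trans mu1_le).
have t_le1 : t <= 1 by rewrite ler_pdivrMr ?subr_gt0 ?(le_lt_trans mu1_le)// mul1r lerD2l lerN2.
have -> : 1 - mu2 M K r - (mu1 M K r * m - mu2 M K r) * t =
  (1 - t) * (1 - mu2 M K r) + t * (1 - mu1 M K r * m) by ring.
have mix : (1 - t) * (1 - mu2 M K r) + t * (1 - mu1 M K r * m) <= 2 * (m * r / q).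
  by nra.
have -> : 2 * (k / q) = k / (m * r) * (2 * (m * r / q)) by field; rewrite !gt_eqF.
by rewrite ler_wpM2l// ltW// divr_gt0// mulr_gt0.
Qed.
End CornerPoints.

(** * The ratio of achievable to minimum NDT *)

Theorem proposition11 (R : realType) (M K N : nat)
    (M_gt0 : (0 < M)%N) (K_gt0 : (0 < K)%N) (le_KN : (K <= N)%N)
    (dH : measure_display) (OmH : measurableType dH) (PrH : probability OmH R)
    (h : 'I_K * 'I_M -> {RV PrH >-> (R * R)%type})
    (nu : probability (R * R)%type R)
    (nu_continuous : forall z : R * R, nu [set z] = 0%E)
    (h_iid : iid nu h)
    (dZ : measure_display) (OmZ : measurableType dZ) (PrZ : probability OmZ R)
    (Z : 'I_K * nat -> {RV PrZ >-> (R * R)%type})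
    (Z_iid : iid CN01 Z)
    (r : R) (r_gt0 : 0 < r) :
  mu1 M K r <= mu2 M K r <= 1 /\
  forall mu : R, mu1 M K r <= mu <= mu2 M K r ->
    ((NDT_ach M K mu r)%:E / min_NDT N h Z mu r <= 2%:E)%E.
Proof.
split; first exact: mu1_le_mu2.
move=> mu mu_in; have ach_le := NDT_ach_le M_gt0 K_gt0 r_gt0 mu_in.
have := min_NDT_ge h mu r M_gt0 K_gt0 le_KN Z_iid.
have b_gt0 : 0 < K%:R / (minn M K)%:R :> R by rewrite divr_gt0// ltr0n// leq_min M_gt0.
case: (min_NDT N h Z mu r) => [d| |] //.
- rewrite lee_fin => b_le; have d_gt0 : 0 < d by exact: lt_le_trans b_le.
  rewrite inver gt_eqF// -EFinM lee_fin ler_pdivrMr//; apply: (le_trans ach_le).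
  by rewrite ler_pM2l.
(* A minimum NDT equal to [+oo] has inverse [0], so the quotient is [0]. *)
- by move=> _; rewrite invey mule0 lee_fin.
Qed.
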